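(* Let $T\in\mathcal{L}(\mathcal{H})$ have closed range and let $p$ be a complex polynomial in one variable. The following statements are equivalent: (i) $T$ is $p$-EP; (ii) $T^\dagger T\,p(T)\,T^*T=p(T)\,T^*T$ and $TT^\dagger\,\overline{p}(T^* )\,TT^*=\overline{p}(T^* )\,TT^*$; (iii) $T^\dagger T\,p(T)\,T^*=p(T)\,T^*$ and $TT^\dagger\,\overline{p}(T^* )\,T=\overline{p}(T^* )\,T$.
   Context: $\mathcal{H}$ is a complex Hilbert space and $\mathcal{L}(\mathcal{H})$ is the algebra of bounded linear operators on $\mathcal{H}$. For $T\in\mathcal{L}(\mathcal{H})$ with closed range, the Moore-Penrose inverse $T^\dagger$ is the unique operator with $TT^\dagger T=T$, $T^\dagger TT^\dagger=T^\dagger$, $(T^\dagger T)^*=T^\dagger T$, $(TT^\dagger)^*=TT^\dagger$. For a complex polynomial $p$, $\overline{p}$ is the polynomial with conjugated coefficients, $\overline{p}(z)=\overline{p(\overline{z})}$, so that $(p(T))^*=\overline{p}(T^* )$. For a complex polynomial $p$ (the notion is introduced for nontrivial $p$), a closed range operator $T$ is $p$-EP if $p(T)T^\dagger=T^\dagger p(T)$. *)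

(* Defs.v *)
From HB Require Import structures.
From mathcomp Require Import all_boot all_order all_algebra.
From mathcomp Require Import sesquilinear.
From mathcomp Require Import complex.
From mathcomp Require Import boolp classical_sets functions reals topology.
From mathcomp Require Import normedtype.

Set Implicit Arguments.
Unset Strict Implicit.
Unset Printing Implicit Defensive.

Import Order.TTheory GRing.Theory Num.Theory.
Import numFieldNormedType.Exports.

Local Open Scope classical_set_scope.
Local Open Scope ring_scope.

(* The inner product of a {dot H for Num.conj} is linear in its first argument
   and conjugate-linear in its second one. *)
HB.mixin Record CompleteNormedModule_isHilbert (R : realType) H
    of CompleteNormedModule R[i] H := {
  inner : {dot H for (@Num.conj R[i])} ;
  sqr_norm_inner : forall x : H, `|x| ^+ 2 = inner x x }.

#[short(type="hilbertType")]
HB.structure Definition Hilbert (R : realType) :=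
  { H of CompleteNormedModule_isHilbert R H & CompleteNormedModule R[i] H }.

Section BoundedOperators.
Variables (R : realType) (H : hilbertType R).

Definition bounded_pred : {pred H -> H} :=
  fun f => `[< linear f /\ continuous f >].

Record bounded_op :=
  BoundedOp { bounded_op_fun :> H -> H ; _ : bounded_op_fun \in bounded_pred }.

HB.instance Definition _ := [isSub for bounded_op_fun].
HB.instance Definition _ := [Choice of bounded_op by <:].

Fact bounded_pred_submod_closed : submod_closed bounded_pred.
Proof.
split.
  apply/asboolP; split=> [a u v|]; first by rewrite /= scaler0 addr0.
  exact: cst_continuous.
move=> a f g /asboolP[lf cf] /asboolP[lg cg]; apply/asboolP; split.
  move=> b u v; rewrite !fctE lf lg !scalerDr !scalerA.
  by rewrite (mulrC a b) addrACA.
by move=> x; apply: cvgD; [apply: cvgZl_tmp; exact: cf|exact: cg].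
Qed.

HB.instance Definition _ :=
  GRing.isSubmodClosed.Build R[i] (H -> H) bounded_pred
    bounded_pred_submod_closed.
HB.instance Definition _ := [SubChoice_isSubLmodule of bounded_op by <:].

Fact bounded_op_linear (T : bounded_op) : linear T.
Proof. by case: T => f /= /asboolP[]. Qed.

Fact bounded_op_continuous (T : bounded_op) : continuous T.
Proof. by case: T => f /= /asboolP[]. Qed.

HB.instance Definition _ (T : bounded_op) :=
  GRing.isLinear.Build R[i] H H *:%R T (bounded_op_linear T).

Fact idfun_bounded : (idfun : H -> H) \in bounded_pred.
Proof. by apply/asboolP; split=> [//|x]; exact: cvg_id. Qed.

Fact comp_bounded (S T : bounded_op) : S \o T \in bounded_pred.
Proof.
apply/asboolP; split=> [a u v|x]; first by rewrite /= !linearP.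
by apply: continuous_comp; exact: bounded_op_continuous.
Qed.

Definition op_one := BoundedOp idfun_bounded.
Definition op_mul (S T : bounded_op) := BoundedOp (comp_bounded S T).

Fact op_mulA : associative op_mul.
Proof. by move=> S T U; exact/val_inj. Qed.
Fact op_mul1 : left_id op_one op_mul.
Proof. by move=> S; exact/val_inj. Qed.
Fact op_mulr1 : right_id op_one op_mul.
Proof. by move=> S; exact/val_inj. Qed.
Fact op_mulDl : left_distributive op_mul +%R.
Proof. by move=> S T U; exact/val_inj. Qed.
Fact op_mulDr : right_distributive op_mul +%R.
Proof. by move=> S T U; apply/val_inj/funext => x /=; rewrite linearD. Qed.

(* The ring product S * T is the composition S \o T. A pzRingType, as H may be
   the zero space. *)
HB.instance Definition _ := GRing.Zmodule_isPzRing.Build bounded_op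
  op_mulA op_mul1 op_mulr1 op_mulDl op_mulDr.

(* horner_alg is not available here, as it requires 1 != 0 in the algebra. *)
Definition op_poly (p : {poly R[i]}) (T : bounded_op) : bounded_op :=
  \sum_(i < size p) p`_i *: T ^+ i.

Definition is_adjoint (T S : bounded_op) :=
  forall x y, inner (T x) y = inner x (S y).

(* For every bounded T exactly one S satisfies is_adjoint T S, so that the
   default value 0 of xget is never taken. *)
Definition adjoint (T : bounded_op) : bounded_op :=
  xget 0 [set S | is_adjoint T S].

Definition closed_range (T : bounded_op) := closed (range T).

Definition is_mpinv (T S : bounded_op) :=
  [/\ T * S * T = T, S * T * S = S,
      adjoint (S * T) = S * T & adjoint (T * S) = T * S].

(* For every T of closed range exactly one S satisfies is_mpinv T S; the
   default value 0 is taken only when the range of T is not closed. *)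
Definition mpinv (T : bounded_op) : bounded_op :=
  xget 0 [set S | is_mpinv T S].

Definition p_EP (p : {poly R[i]}) (T : bounded_op) :=
  closed_range T /\ op_poly p T * mpinv T = mpinv T * op_poly p T.

End BoundedOperators.

Definition conj_poly (R : realType) (p : {poly R[i]}) : {poly R[i]} :=
  map_poly Num.conj p.

(* Main.v *)
Require Import Defs.
From HB Require Import structures.
From mathcomp Require Import all_boot all_order all_algebra.
From mathcomp Require Import complex.
From mathcomp Require Import boolp classical_sets reals topology.
From mathcomp Require Import normedtype sequences.
From mathcomp Require Import lra.

Set Implicit Arguments.
Unset Strict Implicit.
Unset Printing Implicit Defensive.

Import Order.TTheory GRing.Theory Num.Theory.
Import numFieldNormedType.Exports.

Local Open Scope classical_set_scope.
Local Open Scope ring_scope.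

(** Everything except the existence of adjoints and of the Moore-Penrose inverse
    is algebra.  Write P for p(T) and S for the Moore-Penrose inverse of T; the
    operators S T and T S are the orthogonal projections onto the ranges of T^*
    and of T.  In statement (iii) the first equation says that P maps the range
    of T^* into itself and the second one that P^* maps the range of T into
    itself, which amounts to P leaving the kernel of T^* invariant.  Since P commutes with T, it also leaves the kernel and the range
    of T invariant, so that P commutes with both projections
    ([mpinv_comm_reducing], [reducing_mpinv_comm]); then P S and S P both reduce
    to S P T S.  Statement (ii) is (iii) multiplied on the right by T,
    respectively T^*, a step undone by the identities T^* T S = T^* and
    T T^* S^* = T.

    The definitions of [adjoint] and [mpinv] pick a witness if there is one, so
    the substance lies in two existence theorems.

    Adjoints come from the Riesz representation theorem ([riesz]), hence from
    the orthogonal projection onto a closed subspace ([projection_exists]).  A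
    point of a subspace M that nearly minimizes the distance to x has a residual
    nearly orthogonal to M, and near orthogonality alone makes a sequence of
    such points Cauchy.

    For the Moore-Penrose inverse of an operator with closed range, let E be the
    orthogonal projection onto that range.  Uniform boundedness, applied to the
    vectors w of the range with |T^* w| <= 1, bounds T^* below on the range of T
    ([adjoint_bounded_below]); consequently A = T T^* + (1 - E) is self-adjoint
    and bounded below, hence invertible ([selfadjoint_inverse]), and T^* A^-1
    satisfies the four Penrose equations ([mpinv_exists]).  Uniform boundedness
    itself is proved by a gliding hump argument, which needs completeness of the
    space but no Baire category argument ([uniform_boundedness]). *)

(** * Real-valued norms over the complex numbers *)

Section RealNorm.
Variable R : realType.

(** The norm of a complex normed space takes its values in the merely partially
    ordered field [R[i]]; its real part lives in [R], where infima exist and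
    linear arithmetic is decidable. *)
Definition rnorm (V : normedZmodType R[i]) (v : V) : R := complex.Re `|v|.

Lemma rnormE (V : normedZmodType R[i]) (v : V) : `|v| = (rnorm v)%:C%C.
Proof. by rewrite /rnorm RRe_real ?normr_real. Qed.

Lemma rnorm_le (V : normedZmodType R[i]) (v : V) (r : R) :
  (rnorm v <= r) = (`|v| <= r%:C%C).
Proof. by rewrite rnormE lecR. Qed.

Lemma rnorm_ge0 (V : normedZmodType R[i]) (v : V) : 0 <= rnorm v.
Proof. by rewrite -lecR -rnormE normr_ge0. Qed.

Lemma rnorm0 (V : normedZmodType R[i]) : rnorm (0 : V) = 0.
Proof. by rewrite /rnorm normr0. Qed.

Lemma rnorm_eq0 (V : normedZmodType R[i]) (v : V) : (rnorm v == 0) = (v == 0).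
Proof. by rewrite -(normr_eq0 v) rnormE (inj_eq (@complexI R) _ 0). Qed.

Lemma rnormD (V : normedZmodType R[i]) (u v : V) :
  rnorm (u + v) <= rnorm u + rnorm v.
Proof. by rewrite rnorm_le rmorphD /= -!rnormE ler_normD. Qed.

Lemma rnormN (V : normedZmodType R[i]) (v : V) : rnorm (- v) = rnorm v.
Proof. by rewrite /rnorm normrN. Qed.

Lemma rnormB (V : normedZmodType R[i]) (u v : V) :
  rnorm (u - v) <= rnorm u + rnorm v.
Proof. by rewrite -(rnormN v) rnormD. Qed.

Lemma rnorm_distC (V : normedZmodType R[i]) (u v : V) :
  rnorm (u - v) = rnorm (v - u).
Proof. by rewrite -rnormN opprB. Qed.

Lemma rnorm_real (r : R) : rnorm (r%:C%C : R[i]) = `|r|.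
Proof.
by rewrite /rnorm normc_def /= expr0n addr0 sqrtr_sqr.
Qed.

Lemma rnormM (a b : R[i]) : rnorm (a * b) = rnorm a * rnorm b.
Proof. by apply: complexI; rewrite rmorphM /= -!rnormE normrM. Qed.

Lemma rnormZ (V : normedModType R[i]) a (v : V) :
  rnorm (a *: v) = rnorm a * rnorm v.
Proof. by apply: complexI; rewrite rmorphM /= -!rnormE normrZ. Qed.

Lemma rnorm_small_eq0 (V : normedZmodType R[i]) (v : V) c :
  (forall e, 0 < e -> rnorm v <= c * e) -> v = 0.
Proof.
move=> small; apply/eqP; rewrite -rnorm_eq0 eq_le rnorm_ge0 andbT.
apply/ler_addgt0Pr => e e0; rewrite add0r.
have c0 : 0 < `|c| + 1 by rewrite ltr_wpDl.
have /le_trans := small (e / (`|c| + 1)) (divr_gt0 e0 c0); apply.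
rewrite mulrCA ger_pMr// ler_pdivrMr// mul1r.
by have := ler_norm c; lra.
Qed.

(** Closedness phrased with norms, so that it can be checked by estimates. *)
Definition approx_closed (V : normedZmodType R[i]) (M : set V) :=
  forall x, (forall e, 0 < e -> exists2 y, M y & rnorm (x - y) <= e) -> M x.

Lemma closed_approx_closed (V : normedModType R[i]) (M : set V) :
  closed M -> approx_closed M.
Proof.
move=> Mc x xM; apply: Mc => B /nbhs_normP[e /= e0 eB].
have [e1 e1E] : exists e1, e = e1%:C%C.
  by exists (complex.Re e); rewrite RRe_real// gtr0_real.
move: e0; rewrite e1E ltcR => e10.
have [y My xy] := xM _ (divr_gt0 e10 (ltr0n R 2)).
exists y; split=> //; apply: eB => /=.
by rewrite e1E rnormE ltcR (le_lt_trans xy)//; lra.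
Qed.

(** Letting m go to infinity in the Cauchy bound [e n] keeps it valid for the
    limit, which yields a rate of convergence. *)
Lemma rnorm_complete (V : completeNormedModType R[i]) (u : V^nat) (e : R^nat) :
    (forall n m, (n <= m)%N -> rnorm (u m - u n) <= e n) ->
    (forall d, 0 < d -> exists n, e n <= d) ->
  exists l, forall n, rnorm (l - u n) <= e n.
Proof.
move=> ue e0.
have /cauchy_cvgP/cvg_ex[l ul] : cauchy (u @ \oo).
  apply/cauchy_exP => d d0.
  have [d1 d1E] : exists d1, d = d1%:C%C.
    by exists (complex.Re d); rewrite RRe_real// gtr0_real.
  move: d0; rewrite d1E ltcR => d10.
  have [n en] := e0 _ (divr_gt0 d10 (ltr0n R 2)).
  exists (u n); exists n => //= m /= nm.
  rewrite -ball_normE /ball_/= rnormE ltcR rnorm_distC.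
  by rewrite (le_lt_trans (ue _ _ nm))// (le_lt_trans en)//; lra.
exists l => n; apply/ler_addgt0Pr => d d0.
have /cvgrPdist_lt/(_ d%:C%C) := ul; rewrite ltcR => /(_ d0)[N _ Nul].
have := Nul (maxn n N) (leq_maxr _ _).
rewrite /= rnormE ltcR => lu.
have := ue n (maxn n N) (leq_maxl _ _).
have := rnormD (l - u (maxn n N)) (u (maxn n N) - u n).
by rewrite addrA subrK; lra.
Qed.

End RealNorm.

(** * Inner products *)

Section InnerProduct.
Variables (R : realType) (H : hilbertType R).
Implicit Types (x y z : H).

Lemma innerDl x y z : inner (x + y) z = inner x z + inner y z.
Proof. by rewrite linearDl. Qed.
Lemma innerDr x y z : inner z (x + y) = inner z x + inner z y.
Proof. by rewrite linearDr. Qed.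
Lemma innerBl x y z : inner (x - y) z = inner x z - inner y z.
Proof. by rewrite linearBl. Qed.
Lemma innerBr x y z : inner z (x - y) = inner z x - inner z y.
Proof. by rewrite linearBr. Qed.
Lemma innerZl a x y : inner (a *: x) y = a * inner x y.
Proof. by rewrite linearZl_LR. Qed.
Lemma innerZr a x y : inner x (a *: y) = Num.conj a * inner x y.
Proof. by rewrite linearZr_LR. Qed.
Lemma inner0l x : inner 0 x = 0.
Proof. by rewrite linear0l. Qed.
Lemma inner0r x : inner x 0 = 0.
Proof. by rewrite linear0r. Qed.
Lemma innerC x y : inner x y = Num.conj (inner y x).
Proof. by rewrite hermC mul1r. Qed.

Lemma innerxx x : inner x x = ((rnorm x) ^+ 2)%:C%C.
Proof. by rewrite -sqr_norm_inner rnormE rmorphXn. Qed.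

Lemma inner_eq0 x : inner x x = 0 -> x = 0.
Proof.
by rewrite innerxx => /complexI/eqP; rewrite sqrf_eq0 rnorm_eq0 => /eqP.
Qed.

Lemma rnorm_inner x : rnorm (inner x x) = rnorm x ^+ 2.
Proof. by rewrite innerxx rnorm_real ger0_norm// sqr_ge0. Qed.

(** Pythagoras for the component of [x] orthogonal to [z], multiplied by
    [rnorm z ^+ 2] so that it holds at [z = 0] too.  It gives both the
    Cauchy-Schwarz inequality and the near orthogonality of near minimizers. *)
Lemma rnorm_residual x z :
  rnorm z ^+ 2 * rnorm (x - (inner x z / inner z z) *: z) ^+ 2 =
  rnorm z ^+ 2 * rnorm x ^+ 2 - rnorm (inner x z) ^+ 2.
Proof.
have [->|z0] := eqVneq z 0.
  by rewrite inner0r !rnorm0 expr0n !mul0r subrr.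
have zz0 : inner z z != 0 by apply: contra z0 => /eqP/inner_eq0 ->.
set a := _ / _; have az : a * inner z z = inner x z by rewrite divfK.
apply: complexI; rewrite rmorphB [LHS]rmorphM [X in _ = X - _]rmorphM /=.
rewrite -!innerxx rmorphXn /= -rnormE.
rewrite normCK -innerC innerBl !innerBr !innerZr !innerZl az.
rewrite opprB addrA subrK mulrBr; congr (_ - _).
by rewrite mulrA (mulrC _ a) az.
Qed.

Lemma cauchy_schwarz x y : rnorm (inner x y) <= rnorm x * rnorm y.
Proof.
rewrite -(ler_pXn2r (ltn0Sn 1)) ?nnegrE ?mulr_ge0 ?rnorm_ge0//.
have := rnorm_residual x y.
have : 0 <= rnorm y ^+ 2 * rnorm (x - (inner x y / inner y y) *: y) ^+ 2.
  by rewrite mulr_ge0 ?sqr_ge0.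
rewrite exprMn; lra.
Qed.

Lemma inner_inj x y : (forall z, inner z x = inner z y) -> x = y.
Proof.
by move=> xy; apply/subr0_eq/inner_eq0; rewrite innerBr xy subrr.
Qed.

End InnerProduct.

(** * Orthogonal projection and Riesz representation *)

Section Subspaces.
Variables (R : realType) (H : hilbertType R).
Implicit Types (M : set H) (x y z : H).

Definition vsubspace M :=
  M 0 /\ forall a u v, M u -> M v -> M (a *: u + v).

Lemma vsubspaceB M x y : vsubspace M -> M x -> M y -> M (x - y).
Proof. by move=> [_ lM] Mx My; rewrite addrC -scaleN1r; exact: lM. Qed.

(** If the squared distance from [x] to [y] exceeds its infimum by less than
    [d ^+ 2], moving [y] along [z] cannot gain more than [d ^+ 2]; the optimal
    move gains the square of [rnorm (inner (x - y) z) / rnorm z]. *)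
Lemma almost_projection M x (d : R) : vsubspace M -> 0 < d ->
  exists2 y, M y & forall z, M z -> rnorm (inner (x - y) z) <= d * rnorm z.
Proof.
move=> [M0 lM] d0; pose D := [set rnorm (x - y) ^+ 2 | y in M].
have Dinf : has_inf D.
  split; first by exists (rnorm (x - 0) ^+ 2), 0.
  by exists 0 => _ [y _ <-]; exact: sqr_ge0.
have [_ [y My <-] xy] := inf_adherent (exprn_gt0 2 d0) Dinf.
exists y => // z Mz.
set a := inner (x - y) z / inner z z.
have far : inf D <= rnorm (x - y - a *: z) ^+ 2.
  apply: ge_inf; first by case: Dinf.
  by exists (a *: z + y); [exact: lM|rewrite opprD addrCA addrC].
rewrite -(ler_pXn2r (ltn0Sn 1)) ?nnegrE ?mulr_ge0 ?rnorm_ge0 ?(ltW d0)//.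
have := rnorm_residual (x - y) z; rewrite -/a.
have : rnorm z ^+ 2 * inf D <= rnorm z ^+ 2 * rnorm (x - y - a *: z) ^+ 2.
  by rewrite ler_wpM2l ?sqr_ge0.
have : rnorm z ^+ 2 * rnorm (x - y) ^+ 2 <= rnorm z ^+ 2 * (inf D + d ^+ 2).
  by rewrite ler_wpM2l ?sqr_ge0 ?ltW.
rewrite exprMn mulrDr; lra.
Qed.

Lemma scaled_exp_half_le (c d : R) : 0 < d -> exists n, c * 2^-1 ^+ n <= d.
Proof.
move=> d0; have c0 : 0 < `|c| + 1 by rewrite ltr_wpDl.
have : (fun n => 2^-1 ^+ n : R) @ \oo --> 0.
  by apply: cvg_expr; rewrite ger0_norm ?invf_lt1 ?invr_ge0// ltr1n.
move=> /cvgrPdist_lt/(_ (d / (`|c| + 1)) (divr_gt0 d0 c0))[n _].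
move=> /(_ n (leqnn n)).
rewrite /= sub0r normrN ger0_norm ?exprn_ge0 ?invr_ge0// => nd.
exists n; rewrite (@le_trans _ _ ((`|c| + 1) * 2^-1 ^+ n))//.
  rewrite ler_wpM2r ?exprn_ge0 ?invr_ge0//.
  by have := ler_norm c; lra.
by rewrite mulrC -ler_pdivlMr// ltW.
Qed.

(** Testing the near orthogonality of two approximations against their own
    difference shows that they are close to each other. *)
Lemma projection_exists M x : vsubspace M -> approx_closed M ->
  exists2 y, M y & forall z, M z -> inner (x - y) z = 0.
Proof.
move=> sM cM.
have half_gt0 n : 0 < 2^-1 ^+ n :> R by rewrite exprn_gt0 ?invr_gt0.
have /choice[u uP] : forall n, exists y, M y /\
    forall z, M z -> rnorm (inner (x - y) z) <= 2^-1 ^+ n * rnorm z.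
  by move=> n; have [y My yP] := almost_projection x sM (half_gt0 n); exists y.
have [|d d0|l ul] := rnorm_complete (u := u) (e := fun n => 2 * 2^-1 ^+ n).
(* near orthogonality of both residuals to v, tested on v itself *)
- move=> n m nm; set v := u m - u n.
  have Mv : M v by apply: vsubspaceB => //; apply: (uP _).1.
  have : rnorm v ^+ 2 <= (2 * 2^-1 ^+ n) * rnorm v.
    have vE : v = (x - u n) - (x - u m).
      by rewrite opprB addrC addrA subrK.
    rewrite -rnorm_inner {1}vE innerBl (le_trans (rnormB _ _))//.
    have := (uP n).2 _ Mv; have := (uP m).2 _ Mv.
    have : 2^-1 ^+ m * rnorm v <= 2^-1 ^+ n * rnorm v.
      rewrite ler_wpM2r ?rnorm_ge0// ler_wiXn2l// ?invr_ge0// invf_le1//.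
      by rewrite ler1n.
    lra.
  have [->|v0] := eqVneq v 0; first by rewrite rnorm0 mulr_ge0// ltW.
  by rewrite expr2 ler_pM2r// lt_def rnorm_eq0 v0 rnorm_ge0.
- exact: scaled_exp_half_le.
exists l.
  apply: cM => d d0; have [n nd] := scaled_exp_half_le 2 d0.
  by exists (u n); [exact: (uP n).1|exact: le_trans (ul n) nd].
move=> z Mz; apply: (@rnorm_small_eq0 _ _ _ (3 * rnorm z)) => d d0.
have [n nd] := scaled_exp_half_le 1 d0; rewrite mul1r in nd.
have -> : x - l = (x - u n) - (l - u n) by rewrite opprB addrA subrK.
rewrite innerBl (le_trans (rnormB _ _))//.
have h1 := (uP n).2 _ Mz; have h2 := cauchy_schwarz (l - u n) z.
have z0 := rnorm_ge0 z.
have h3 : rnorm (l - u n) * rnorm z <= 2 * 2^-1 ^+ n * rnorm z.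
  by rewrite ler_wpM2r.
have h4 : 2^-1 ^+ n * rnorm z <= d * rnorm z by rewrite ler_wpM2r.
lra.
Qed.

Lemma lipschitz_ker_approx_closed (f : H -> R[i]) C :
    (forall x y, f (x - y) = f x - f y) ->
    (forall x, rnorm (f x) <= C * rnorm x) ->
  approx_closed [set x | f x = 0].
Proof.
move=> fB fC x xK; apply: (@rnorm_small_eq0 _ _ _ `|C|) => d d0.
have [y fy xy] := xK d d0.
have -> : f x = f (x - y) by rewrite fB fy subr0.
rewrite (le_trans (fC _))// (@le_trans _ _ (`|C| * rnorm (x - y)))//.
  by rewrite ler_wpM2r ?rnorm_ge0// ler_norm.
by rewrite ler_wpM2l.
Qed.

(** A vector orthogonal to the kernel of [f] represents [f] up to scaling, since
    the kernel has codimension at most one. *)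
Lemma riesz (f : H -> R[i]) C :
    (forall a x y, f (a *: x + y) = a * f x + f y) ->
    (forall x, rnorm (f x) <= C * rnorm x) ->
  exists y, forall x, f x = inner x y.
Proof.
move=> lf fC.
have f0 : f 0 = 0.
  by have := lf (-1) 0 0; rewrite scaler0 addr0 mulN1r addNr.
have fB x y : f (x - y) = f x - f y.
  by rewrite addrC -scaleN1r lf mulN1r addrC.
have fZ a x : f (a *: x) = a * f x by rewrite -[_ *: x]addr0 lf f0 addr0.
have [fn|/existsNP[x0 fx0]] := pselect (forall x, f x = 0).
  by exists 0 => x; rewrite inner0r fn.
pose K : set H := [set x | f x = 0].
have sK : vsubspace K.
  by split=> [|a u v fu fv]; rewrite /K/= ?f0 ?lf ?fu ?fv ?mulr0 ?addr0.
have [p fp vK] := projection_exists x0 sK (lipschitz_ker_approx_closed fB fC).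
set v := x0 - p in vK.
have fv0 : f v != 0 by rewrite fB fp subr0; exact/eqP.
have vv0 : inner v v != 0.
  by apply: contra fv0 => /eqP/inner_eq0 ->; rewrite f0.
exists (Num.conj (f v / inner v v) *: v) => x.
rewrite innerZr conjCK.
have : inner v (f v *: x - f x *: v) = 0.
  by apply: vK; rewrite /K/= fB !fZ mulrC subrr.
move=> /(congr1 (@Num.conj _)); rewrite -innerC rmorph0 innerBl !innerZl.
move=> /eqP; rewrite subr_eq0 => /eqP xv.
by apply: (mulIf vv0); rewrite -xv mulrAC divfK.
Qed.

End Subspaces.

(** * Operators defined by relations, and adjoints *)

Section Operators.
Variables (R : realType) (H : hilbertType R).
Implicit Types (x y z : H) (S T U : bounded_op H).

Lemma op_bounded T : exists2 C, 0 < C & forall x, rnorm (T x) <= C * rnorm x.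
Proof.
have /linear_boundedP/pinfty_ex_gt0[C C0 TC] :
    bounded_near (T : {linear H -> H}) (nbhs (0 : H)).
  by apply/linear_bounded_continuous; exact: bounded_op_continuous.
have CE : C = (complex.Re C)%:C%C by rewrite RRe_real// gtr0_real.
move: C0; rewrite CE ltcR => C0; exists (complex.Re C) => // x.
by rewrite rnorm_le rmorphM /= -rnormE -CE; exact: TC.
Qed.

(** The bound makes the relation single-valued as well as continuous, because a
    linear relation is single-valued as soon as it relates 0 only to 0.  Adjoints,
    projections and inverses are all obtained in this way. *)
Lemma op_of_relation (G : H -> H -> Prop) (C : R) :
    (forall x, exists y, G x y) ->
    (forall a x y x' y', G x y -> G x' y' -> G (a *: x + x') (a *: y + y')) ->
    (forall x y, G x y -> rnorm y <= C * rnorm x) ->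
  exists S, forall x, G x (S x).
Proof.
move=> /choice[f fG] Glin Gbd.
have Gfun x y y' : G x y -> G x y' -> y = y'.
  move=> Gy Gy'; apply/subr0_eq/eqP; rewrite -rnorm_eq0 eq_le rnorm_ge0 andbT.
  have /Gbd := Glin (-1) _ _ _ _ Gy' Gy.
  by rewrite !scaleN1r addNr rnorm0 mulr0 addrC.
have lf : linear f.
  by move=> a x y; apply: Gfun (fG _) _; apply: Glin.
pose fl : {linear H -> H} := HB.pack f (GRing.isLinear.Build _ _ _ _ f lf).
have cf : continuous f.
  apply: (@bounded_linear_continuous _ _ _ fl).
  apply/linear_boundedP; exists `|C|%:C%C; split.
    by rewrite complex_real.
  move=> r Cr x; rewrite (rnormE (f x)).
  rewrite (@le_trans _ _ (`|C|%:C%C * `|x|))//; last first.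
    by rewrite ler_wpM2r// ltW.
  rewrite rnormE -rmorphM /= lecR (le_trans (Gbd _ _ (fG x)))//.
  by rewrite ler_wpM2r ?rnorm_ge0// ler_norm.
have bf : f \in @bounded_pred R H by apply/asboolP.
by exists (BoundedOp bf).
Qed.

Lemma op_ext S T : (forall x, S x = T x) -> S = T.
Proof. by move=> ST; apply/val_inj/funext. Qed.

Lemma op_mulE S T x : (S * T) x = S (T x). Proof. by []. Qed.
Lemma op_addE S T x : (S + T) x = S x + T x. Proof. by []. Qed.
Lemma op_scaleE a T x : (a *: T) x = a *: T x. Proof. by []. Qed.
Lemma op_oppE T x : (- T) x = - T x. Proof. by []. Qed.

(** With [z] the representing vector at [y], the bound follows from
    [rnorm z ^+ 2 = rnorm (inner (T z) y)]. *)
Lemma adjoint_exists T : exists S, is_adjoint T S.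
Proof.
have [C C0 TC] := op_bounded T.
have TCi x y : rnorm (inner (T x) y) <= C * rnorm y * rnorm x.
  rewrite (le_trans (cauchy_schwarz _ _))// mulrAC ler_wpM2r ?rnorm_ge0//.
have [||y z yz|S ST] := @op_of_relation
    (fun y z => forall x, inner (T x) y = inner x z) C.
- move=> y; apply: (@riesz _ _ (fun x => inner (T x) y) (C * rnorm y)) => //.
  by move=> a x x'; rewrite linearP innerDl innerZl.
- move=> a y z y' z' yz yz' x.
  by rewrite !innerDr !innerZr yz yz'.
- have [->|z0] := eqVneq z 0.
    by rewrite rnorm0 mulr_ge0 ?rnorm_ge0// ltW.
  have z1 : 0 < rnorm z by rewrite lt_def rnorm_eq0 z0 rnorm_ge0.
  by rewrite -(ler_pM2r z1) -expr2 -rnorm_inner -yz.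
by exists S => x y; exact: ST.
Qed.

Lemma inner_adjointr T x y : inner (T x) y = inner x (adjoint T y).
Proof.
have : is_adjoint T (adjoint T).
  by have [S ST] := adjoint_exists T; apply: (xgetPex 0); exists S.
exact.
Qed.

Lemma inner_adjointl T x y : inner x (T y) = inner (adjoint T x) y.
Proof. by rewrite innerC inner_adjointr -innerC. Qed.

Lemma adjoint_uniq T S : is_adjoint T S -> adjoint T = S.
Proof.
move=> TS; apply: op_ext => y; apply: inner_inj => x.
by rewrite -inner_adjointr TS.
Qed.

Lemma adjointK T : adjoint (adjoint T) = T.
Proof. by apply: adjoint_uniq => x y; rewrite inner_adjointl. Qed.

Lemma adjointM S T : adjoint (S * T) = adjoint T * adjoint S.
Proof. by apply: adjoint_uniq => x y; rewrite !op_mulE !inner_adjointr. Qed.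

Lemma adjoint1 : adjoint 1 = 1 :> bounded_op H.
Proof. exact: adjoint_uniq. Qed.

Lemma adjointD S T : adjoint (S + T) = adjoint S + adjoint T.
Proof.
by apply: adjoint_uniq => x y; rewrite !op_addE innerDl innerDr !inner_adjointr.
Qed.

Lemma adjointZ a T : adjoint (a *: T) = Num.conj a *: adjoint T.
Proof.
apply: adjoint_uniq => x y.
by rewrite !op_scaleE innerZl innerZr conjCK inner_adjointr.
Qed.

Lemma adjoint0 : adjoint 0 = 0 :> bounded_op H.
Proof. by apply: adjoint_uniq => x y; rewrite inner0l inner0r. Qed.

Lemma adjointX T n : adjoint (T ^+ n) = adjoint T ^+ n.
Proof.
elim: n => [|n IH]; first by rewrite !expr0 adjoint1.
by rewrite exprS exprSr adjointM IH.
Qed.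

Lemma op_poly_adjoint p T :
  adjoint (op_poly p T) = op_poly (conj_poly p) (adjoint T).
Proof.
rewrite /op_poly /conj_poly size_map_poly.
rewrite (big_morph _ adjointD adjoint0); apply: eq_bigr => i _.
by rewrite coef_map adjointZ adjointX.
Qed.

Lemma op_poly_comm p T : op_poly p T * T = T * op_poly p T.
Proof.
rewrite /op_poly mulr_suml mulr_sumr; apply: eq_bigr => i _.
have -> : (p`_i *: T ^+ i) * T = p`_i *: (T ^+ i * T) by exact: op_ext.
have -> : T * (p`_i *: T ^+ i) = p`_i *: (T * T ^+ i).
  by apply: op_ext => x; rewrite !op_mulE !op_scaleE linearZ.
by rewrite -exprS exprSr.
Qed.

Lemma orth_projection_exists (M : set H) : vsubspace M -> approx_closed M ->
  exists P : bounded_op H,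
    [/\ forall x, M (P x), forall x, M x -> P x = x & adjoint P = P].
Proof.
move=> sM cM.
have [||x y [My xy]|P PG] := @op_of_relation
    (fun x y => M y /\ forall z, M z -> inner (x - y) z = 0) 1.
- by move=> x; have [y My xy] := projection_exists x sM cM; exists y.
- move=> a x y x' y' [My xy] [My' xy']; split; first exact: sM.2.
  move=> z Mz; rewrite opprD addrACA -scalerBr innerDl innerZl xy// xy'//.
  by rewrite mulr0 addr0.
- rewrite mul1r; have [->|y0] := eqVneq y 0; first by rewrite rnorm0 rnorm_ge0.
  have y1 : 0 < rnorm y by rewrite lt_def rnorm_eq0 y0 rnorm_ge0.
  rewrite -(ler_pM2r y1) -expr2 -rnorm_inner.
  have -> : inner y y = inner x y.
    by apply/esym/subr0_eq; rewrite -innerBl xy.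
  exact: cauchy_schwarz.
exists P; split.
- by move=> x; exact: (PG x).1.
- move=> x Mx; apply/esym/subr0_eq/inner_eq0/(PG x).2.
  by apply: vsubspaceB => //; exact: (PG x).1.
apply: adjoint_uniq => x y.
have : inner (x - P x) (P y) = 0 by apply: (PG x).2; exact: (PG y).1.
have : inner (P x) (y - P y) = 0.
  by rewrite innerC (PG y).2 ?rmorph0//; exact: (PG x).1.
rewrite innerBr innerBl => /subr0_eq -> /subr0_eq -> //.
Qed.

End Operators.

(** * Uniform boundedness *)

Section UniformBoundedness.
Variables (R : realType) (H : hilbertType R).
Implicit Types (x y z w : H).

(** With [d] the multiple of [w] of norm [r], the pairings of [x + d] and
    [x - d] with [w] differ by twice that of [d], so one of them is at least as
    large as the latter. *)
Lemma inner_bump x w (r : R) : 0 <= r ->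
  exists x', rnorm (x' - x) <= r /\ r * rnorm w <= rnorm (inner x' w).
Proof.
move=> r0; have [->|w0] := eqVneq w 0.
  by exists x; rewrite subrr !rnorm0 mulr0 rnorm_ge0.
have w1 : 0 < rnorm w by rewrite lt_def rnorm_eq0 w0 rnorm_ge0.
set d := (r / rnorm w)%:C%C *: w.
have dr : rnorm d = r.
  by rewrite rnormZ rnorm_real ger0_norm ?divfK ?gt_eqF// divr_ge0// ltW.
have dw : rnorm (inner d w) = r * rnorm w.
  rewrite innerZl rnormM rnorm_real rnorm_inner ger0_norm ?divr_ge0// 1?ltW//.
  by rewrite expr2 mulrA divfK ?gt_eqF.
have [le|lt] := lerP (r * rnorm w) (rnorm (inner (x + d) w)).
  by exists (x + d); rewrite addrC addKr dr.
exists (x - d); rewrite addrC addKr rnormN dr; split=> //.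
have := rnormB (inner (x + d) w) (inner (x - d) w).
rewrite -innerBl opprB (addrC (x + d)) addrA subrK.
have -> : inner (d + d) w = 2 * inner d w.
  by rewrite innerDl mulr2n mulrDl mul1r.
rewrite rnormM dw.
have -> : rnorm (2 : R[i]) = 2.
  by rewrite -[2](rmorph_nat (real_complex R)) rnorm_real ger0_norm.
lra.
Qed.

(** Gliding hump: if the norms in [F] were unbounded, take [w n] in [F] growing
    faster than [3 ^ n] and move from [u n] to [u n.+1] by at most [3 ^ -n] so
    that the pairing with [w n] becomes at least [3 ^ -n * rnorm (w n)].  All the
    later moves add up to at most half of [3 ^ -n], so the limit still pairs
    with [w n] to at least half of that value, which is unbounded in [n]. *)
Lemma uniform_boundedness (F : set H) :
    (forall x, exists M, forall w, F w -> rnorm (inner x w) <= M) ->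
  exists M, forall w, F w -> rnorm w <= M.
Proof.
move=> pbF; apply: contrapT => ubF.
have /choice[w wP] : forall n : nat, exists w,
    F w /\ n%:R * 3 ^+ n * 2 < rnorm w.
  move=> n; apply: contrapT => nw; apply: ubF.
  exists (n%:R * 3 ^+ n * 2) => w Fw.
  by rewrite leNgt; apply/negP => lt; apply: nw; exists w.
have t0 n : 0 < 3^-1 ^+ n :> R by rewrite exprn_gt0 ?invr_gt0.
have /choice[g gP] : forall nx : nat * H, exists x',
    rnorm (x' - nx.2) <= 3^-1 ^+ nx.1 /\
    3^-1 ^+ nx.1 * rnorm (w nx.1) <= rnorm (inner x' (w nx.1)).
  by move=> [n x]; apply: inner_bump; rewrite ltW.
pose u := fix u n := if n is m.+1 then g (m, u m) else 0 : H.
have uS n : rnorm (u n.+1 - u n) <= 3^-1 ^+ n by exact: (gP (n, u n)).1.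
have uw n : 3^-1 ^+ n * rnorm (w n) <= rnorm (inner (u n.+1) (w n)).
  exact: (gP (n, u n)).2.
have [||l lu] := rnorm_complete (u := u) (e := fun n => 3 / 2 * 3^-1 ^+ n).
- move=> n m /subnKC <-; move: (m - n)%N => {m} k.
  (* the exact value of the geometric sum makes the induction go through *)
  suff : rnorm (u (n + k)%N - u n) <= 3 / 2 * (3^-1 ^+ n - 3^-1 ^+ (n + k)).
    by have := t0 (n + k)%N; lra.
  elim: k => [|k IH]; first by rewrite addn0 !subrr rnorm0 mulr0.
  have := rnormD (u (n + k.+1)%N - u (n + k)%N) (u (n + k)%N - u n).
  rewrite addrA subrK addnS exprS; have := uS (n + k)%N; lra.
- move=> d d0; have [n nd] := scaled_exp_half_le (3 / 2) d0.
  exists n; apply: le_trans nd; rewrite ler_wpM2l//; first by lra.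
  by rewrite lerXn2r ?nnegrE ?invr_ge0// lef_pV2 ?posrE// ler_nat.
have [M lM] := pbF l.
have Mn n : n%:R <= M.
  have := lM _ (wP n).1; apply: le_trans.
  have h1 := cauchy_schwarz (u n.+1 - l) (w n).
  have h2 : rnorm (u n.+1 - l) * rnorm (w n) <= 1 / 2 * 3^-1 ^+ n * rnorm (w n).
    rewrite ler_wpM2r ?rnorm_ge0// rnorm_distC (le_trans (lu _))// exprS.
    by lra.
  have h3 := rnormD (inner (u n.+1 - l) (w n)) (inner l (w n)).
  rewrite -innerDl subrK in h3.
  have h4 : 3^-1 ^+ n * (n%:R * 3 ^+ n * 2) <= 3^-1 ^+ n * rnorm (w n).
    by rewrite ler_wpM2l ?ltW// (wP n).2.
  have h5 : 3^-1 ^+ n * (n%:R * 3 ^+ n * 2) = n%:R * 2 :> R.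
    by rewrite mulrA mulrCA -exprMn mulVf ?pnatr_eq0// expr1n mulr1.
  have := uw n; lra.
have := Mn (Num.truncn M).+1; apply/negP; rewrite -ltNge.
exact: truncnS_gt.
Qed.

End UniformBoundedness.

(** * Existence of the Moore-Penrose inverse *)

Section MoorePenrose.
Variables (R : realType) (H : hilbertType R).
Implicit Types (x y z : H) (A T P : bounded_op H).

Lemma range_vsubspace T : vsubspace (range T).
Proof.
split; first by exists 0; rewrite ?linear0.
by move=> a _ _ [x _ <-] [y _ <-]; exists (a *: x + y); rewrite ?linearP.
Qed.

(** For [w] in the range of [T] the pairing of [x] with [w] only depends on the
    projection [T a] of [x] onto that range, and the pairing of [T a] with [w] is
    the pairing of [a] with [adjoint T w], which is bounded when the latter is. *)
Lemma adjoint_bounded_below T : closed_range T -> exists2 C, 0 <= C &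
  forall w, range T w -> rnorm w <= C * rnorm (adjoint T w).
Proof.
move=> cT.
have [P [PT Pid Padj]] := orth_projection_exists (range_vsubspace T)
  (closed_approx_closed cT).
have [x|C FC] := @uniform_boundedness _ H
    [set w | range T w /\ rnorm (adjoint T w) <= 1].
  have [a _ aP] := PT x; exists (rnorm a) => w [Tw w1].
  rewrite -(Pid w Tw) -[in X in inner _ X]Padj -inner_adjointr -aP.
  rewrite inner_adjointr.
  by rewrite (le_trans (cauchy_schwarz _ _))// ler_piMr ?rnorm_ge0.
have C0 : 0 <= C.
  rewrite -(rnorm0 H); apply: FC; split; first exact: (range_vsubspace T).1.
  by rewrite linear0 rnorm0.
exists C => // w Tw; have [Tw0|Tw0] := eqVneq (adjoint T w) 0.
  suff -> : w = 0 by rewrite linear0 rnorm0 mulr0.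
  have [x _ xw] := Tw; apply: inner_eq0.
  by rewrite -{1}xw inner_adjointr Tw0 inner0r.
have t1 : 0 < rnorm (adjoint T w) by rewrite lt_def rnorm_eq0 Tw0 rnorm_ge0.
rewrite -ler_pdivrMr// mulrC.
have tE : rnorm ((rnorm (adjoint T w))^-1%:C%C : R[i]) =
    (rnorm (adjoint T w))^-1.
  by rewrite rnorm_real ger0_norm// invr_ge0 ltW.
rewrite -tE -rnormZ; apply: FC; split.
  rewrite -[_ *: w]addr0; apply: (range_vsubspace T).2 => //.
  exact: (range_vsubspace T).1.
by rewrite linearZ/= rnormZ tE mulVf ?gt_eqF.
Qed.

(** The lower bound makes [A] injective with closed range; a vector orthogonal to
    the range lies in the kernel of the adjoint, which is [A] itself, so [A] is
    onto. *)
Lemma selfadjoint_inverse A C : adjoint A = A ->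
    (forall x, rnorm x <= C * rnorm (A x)) ->
  exists B, [/\ A * B = 1, B * A = 1 & adjoint B = B].
Proof.
move=> Aadj AC.
have A0 x : A x = 0 -> x = 0.
  move=> Ax; apply/eqP; rewrite -rnorm_eq0 eq_le rnorm_ge0 andbT.
  by rewrite (le_trans (AC x))// Ax rnorm0 mulr0.
have cA : approx_closed (range A).
  move=> x xA; have [K K0 AK] := op_bounded A.
  have half_gt0 n : 0 < 2^-1 ^+ n :> R by rewrite exprn_gt0 ?invr_gt0.
  have /choice[u uP] : forall n, exists a, rnorm (x - A a) <= 2^-1 ^+ n.
    by move=> n; have [_ [a _ <-] xa] := xA _ (half_gt0 n); exists a.
  have [n m nm|d d0|l lu] := rnorm_complete (u := u)
      (e := fun n => 2 * `|C| * 2^-1 ^+ n).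
  - rewrite (le_trans (AC _))// linearB.
    rewrite (@le_trans _ _ (`|C| * rnorm (A (u m) - A (u n))))//.
      by rewrite ler_wpM2r ?rnorm_ge0// ler_norm.
    rewrite mulrAC mulrC ler_wpM2r//.
    have -> : A (u m) - A (u n) = (x - A (u n)) - (x - A (u m)).
      by rewrite [RHS]addrC opprB addrA subrK.
    rewrite (le_trans (rnormB _ _))//.
    have := uP n; have := uP m.
    have : 2^-1 ^+ m <= 2^-1 ^+ n :> R.
      by rewrite ler_wiXn2l// ?invr_ge0// invf_le1// ler1n.
    lra.
  - exact: scaled_exp_half_le.
  exists l => //; apply/esym/subr0_eq.
  apply: (@rnorm_small_eq0 _ _ _ (1 + K * (2 * `|C|))) => d d0.
  have [n nd] := scaled_exp_half_le 1 d0; rewrite mul1r in nd.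
  have -> : x - A l = (x - A (u n)) - A (l - u n).
    by rewrite linearB opprB addrA subrK.
  rewrite (le_trans (rnormB _ _))//.
  have h1 := uP n; have h2 := AK (l - u n).
  have h3 : K * rnorm (l - u n) <= K * (2 * `|C| * 2^-1 ^+ n).
    by rewrite ler_wpM2l// ltW.
  have h4 : K * (2 * `|C|) * 2^-1 ^+ n <= K * (2 * `|C|) * d.
    by rewrite ler_wpM2l// !mulr_ge0// ltW.
  by rewrite mulrA in h3; lra.
have Asurj y : exists x, A x = y.
  have [_ [a _ <-] yA] := projection_exists y (range_vsubspace A) cA.
  exists a; apply/esym/subr0_eq/A0/inner_eq0.
  by rewrite inner_adjointr Aadj yA//; exists (A (y - A a)).
have [||y x <-|B BP] := @op_of_relation R H (fun y x => A x = y) C.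
- exact: Asurj.
- by move=> a y x y' x' <- <-; rewrite linearP.
- exact: AC.
have AB : A * B = 1 by apply: op_ext => y; exact: BP.
have BA : B * A = 1.
  apply: op_ext => x; apply/subr0_eq/A0.
  by rewrite linearB /= BP subrr.
exists B; split=> //.
by rewrite -[LHS]mulr1 -AB mulrA -{1}Aadj -adjointM AB adjoint1 mul1r.
Qed.

(** With [P] the projection onto the range of [T], the operator [A] equals
    [T * adjoint T] on the range and the identity on its orthogonal complement.
    It commutes with [P], and [P * A = T * adjoint T], so that its inverse [B]
    satisfies [T * (adjoint T * B) = P]; hence the choice [adjoint T * B]. *)
Lemma mpinv_exists T : closed_range T -> exists S, is_mpinv T S.
Proof.
move=> cT; have [C C0 TC] := adjoint_bounded_below cT.
have [P [PT Pid Padj]] := orth_projection_exists (range_vsubspace T)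
  (closed_approx_closed cT).
have P_T : P * T = T by apply: op_ext => x; apply: Pid; exists x.
have PP : P * P = P by apply: op_ext => x; apply: Pid; exact: PT.
have T_P : adjoint T * P = adjoint T.
  by rewrite -{1}Padj -adjointM P_T.
set G := T * adjoint T.
have GP : G * P = G by rewrite -mulrA T_P.
have PG : P * G = G by rewrite mulrA P_T.
have Gadj : adjoint G = G by rewrite adjointM adjointK.
pose Q := 1 - P; pose A := G + Q.
have AP : A * P = G by rewrite mulrDl GP mulrBl mul1r PP subrr addr0.
have PA : P * A = G by rewrite mulrDr PG mulrBr mulr1 PP subrr addr0.
have QQ : Q * Q = Q by rewrite mulrBl mul1r mulrBr mulr1 PP subrr subr0.
have Qadj : adjoint Q = Q.
  by rewrite /Q -scaleN1r adjointD adjointZ Padj adjoint1 rmorphN rmorph1.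
have Aadj : adjoint A = A by rewrite adjointD Gadj Qadj.
(* inner (A x) x = |T^* x|^2 + |Q x|^2, while |x|^2 = |P x|^2 + |Q x|^2 and
   |P x| <= C |T^* x| *)
have Abd x : rnorm x <= (C ^+ 2 + 1) * rnorm (A x).
  have AxE : A x = T (adjoint T x) + Q x by [].
  have PQx : x = P x + Q x by rewrite op_addE op_oppE addrCA subrr addr0.
  have QxE : inner (Q x) x = inner (Q x) (Q x).
    by rewrite -{1}QQ op_mulE inner_adjointr Qadj.
  have PxE : inner (P x) x = inner (P x) (P x).
    by rewrite -{1}PP op_mulE inner_adjointr Padj.
  have AE : rnorm (inner (A x) x) = rnorm (adjoint T x) ^+ 2 + rnorm (Q x) ^+ 2.
    rewrite AxE innerDl inner_adjointr QxE !innerxx -rmorphD rnorm_real.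
    by rewrite ger0_norm// addr_ge0 ?sqr_ge0.
  have xE : rnorm x ^+ 2 = rnorm (P x) ^+ 2 + rnorm (Q x) ^+ 2.
    apply: complexI; rewrite rmorphD /= -!innerxx {1}PQx innerDl.
    by rewrite PxE QxE.
  have Px : rnorm (P x) ^+ 2 <= C ^+ 2 * rnorm (adjoint T x) ^+ 2.
    rewrite -exprMn lerXn2r ?nnegrE ?mulr_ge0 ?rnorm_ge0//.
    by rewrite -T_P; exact: TC.
  have h : rnorm x ^+ 2 <= (C ^+ 2 + 1) * rnorm (A x) * rnorm x.
    have := cauchy_schwarz (A x) x; rewrite AE => cs.
    have c2 : 0 <= C ^+ 2 + 1 by rewrite addr_ge0 ?sqr_ge0.
    have := ler_wpM2l c2 cs; rewrite mulrA; apply: le_trans.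
    have : 0 <= C ^+ 2 * rnorm (Q x) ^+ 2 by rewrite mulr_ge0 ?sqr_ge0.
    have := sqr_ge0 (rnorm (adjoint T x)).
    by rewrite xE mulrDl !mulrDr !mul1r; lra.
  have [->|x0] := eqVneq x 0.
    by rewrite rnorm0 mulr_ge0 ?rnorm_ge0 ?addr_ge0 ?sqr_ge0.
  by rewrite expr2 ler_pM2r// in h; rewrite lt_def rnorm_eq0 x0 rnorm_ge0.
have [B [AB BA Badj]] := selfadjoint_inverse Aadj Abd.
have PB : P * B = B * P.
  by rewrite -[LHS]mul1r -BA -!mulrA (mulrA A P) AP -PA -(mulrA P) AB mulr1.
exists (adjoint T * B).
have TS : T * (adjoint T * B) = P by rewrite mulrA -/G -PA -mulrA AB mulr1.
split.
- by rewrite TS.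
- by rewrite -mulrA TS -mulrA -PB mulrA T_P.
- by rewrite !adjointM adjointK Badj mulrA.
- by rewrite TS.
Qed.

Lemma mpinvP T : closed_range T -> is_mpinv T (mpinv T).
Proof. by move=> /mpinv_exists[S TS]; apply: (xgetPex 0); exists S. Qed.

End MoorePenrose.

(** * Commutation with the Moore-Penrose inverse *)

Section Commutation.
Variables (R : realType) (H : hilbertType R) (T S P : bounded_op H).
Hypotheses (mpS : is_mpinv T S) (PT : P * T = T * P).

Lemma mpinv_domain_proj_adjoint : S * T * adjoint T = adjoint T.
Proof. by case: mpS => TST _ ST _; rewrite -ST -adjointM mulrA TST. Qed.

Lemma adjoint_mpinv_range_proj : adjoint T * T * S = adjoint T.
Proof. by case: mpS => TST _ _ TS; rewrite -mulrA -TS -adjointM TST. Qed.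

Lemma range_proj_adjoint_mpinv : T * adjoint T * adjoint S = T.
Proof. by case: mpS => TST _ ST _; rewrite -mulrA -adjointM ST mulrA TST. Qed.

(** An operator commuting with [T] and [S] commutes with the projections [S * T]
    and [T * S], which fix the ranges of [adjoint T] and [T]. *)
Lemma mpinv_comm_reducing : P * S = S * P ->
  S * T * P * adjoint T = P * adjoint T /\
  T * S * adjoint P * T = adjoint P * T.
Proof.
case: mpS => TST _ _ TS PS; split.
  have -> : S * T * P = P * (S * T) by rewrite -mulrA -PT !mulrA PS.
  by rewrite -mulrA mpinv_domain_proj_adjoint.
have -> : T * S * adjoint P = adjoint P * (T * S).
  by rewrite -TS -!adjointM mulrA PT -!mulrA PS.
by rewrite -mulrA TST.
Qed.

(** Both sides are equal to [S * P * T * S]: the first equation lets [S * T] be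
    inserted to the left of [P] in [P * S = P * (S * T) * S], and the adjoint of
    the second one lets [T * S] be inserted to the right of [P] in
    [S * P = S * (T * S) * P]. *)
Lemma reducing_mpinv_comm :
    S * T * P * adjoint T = P * adjoint T ->
    T * S * adjoint P * T = adjoint P * T ->
  P * S = S * P.
Proof.
case: mpS => TST STS ST TS e1 e2.
have PST : S * T * P * (S * T) = P * (S * T).
  by rewrite -{2 3}ST adjointM !mulrA e1.
have TSP : T * S * P * (T * S) = T * S * P.
  have SaTa : adjoint S * adjoint T = T * S by rewrite -adjointM TS.
  have := congr1 (fun X => adjoint S * adjoint X) e2.
  by rewrite !adjointM adjointK SaTa !(mulrA (adjoint S)) SaTa !mulrA.
have -> : P * S = S * T * P * S.
  by rewrite -{1}STS mulrA -PST -(mulrA _ _ S) STS.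
have -> : S * P = S * P * T * S.
  by rewrite -{1}STS -(mulrA S T) -(mulrA S (T * S)) -TSP !mulrA STS.
by rewrite -(mulrA S P) PT mulrA.
Qed.
End Commutation.

Theorem corollary5 (R : realType) (H : hilbertType R) (T : bounded_op H)
    (p : {poly R[i]}) (hT : closed_range T) :
  [<-> (* (i) *)
       p_EP p T;
       (* (ii) *)
       mpinv T * T * op_poly p T * adjoint T * T =
         op_poly p T * adjoint T * T
       /\ T * mpinv T * op_poly (conj_poly p) (adjoint T) * T * adjoint T =
         op_poly (conj_poly p) (adjoint T) * T * adjoint T;
       (* (iii) *)
       mpinv T * T * op_poly p T * adjoint T = op_poly p T * adjoint T
       /\ T * mpinv T * op_poly (conj_poly p) (adjoint T) * T =
         op_poly (conj_poly p) (adjoint T) * T].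
Proof.
have mpS := mpinvP hT; have PT := op_poly_comm p T.
rewrite -op_poly_adjoint; tfae.
- move=> [_ /(mpinv_comm_reducing mpS PT)[e1 e2]].
  by rewrite e1 e2.
- move=> [e1 e2]; split.
    by rewrite -(adjoint_mpinv_range_proj mpS) !mulrA e1.
  have := congr1 (fun X => X * adjoint (mpinv T)) e2.
  by rewrite -!mulrA !(mulrA T (adjoint T)) (range_proj_adjoint_mpinv mpS).
- by move=> [e1 e2]; split=> //; exact: (reducing_mpinv_comm mpS PT).
Qed.
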